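(* Let $\mathbb{K}$ be a semiring, $\Sigma=\Sigma_{\mathrm{call}}\sqcup\Sigma_{\mathrm{int}}\sqcup\Sigma_{\mathrm{ret}}$ a visibly pushdown alphabet, and $M$ the OPM on $\Sigma$ given by: for $a\in\Sigma_{\mathrm{call}}$, $a\lessdot b$ if $b\in\Sigma_{\mathrm{call}}\cup\Sigma_{\mathrm{int}}$ and $a\doteq b$ if $b\in\Sigma_{\mathrm{ret}}$; for $a\in\Sigma_{\mathrm{ret}}\cup\Sigma_{\mathrm{int}}$, $a\gtrdot b$ for all $b\in\Sigma$ (together with $\#\lessdot a$ and $a\gtrdot\#$ for all $a\in\Sigma$). Then for every weighted nested word automaton (wNWA) $\mathcal{A}$ over $\Sigma$ and $\mathbb{K}$ there exists an rwOPA $\mathcal{B}$ over $(\Sigma,M)$ and $\mathbb{K}$ with $[\![\mathcal{A}]\!](w)=[\![\mathcal{B}]\!](w)$ for all $w\in(\Sigma,M)^+$.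
   Context: A semiring $\mathbb{K}=(K,+,\cdot,0,1)$ has $(K,+,0)$ a commutative monoid, $(K,\cdot,1)$ a monoid, both distributive laws, and $0\cdot x=x\cdot 0=0$; multiplication need not be commutative. OP alphabets. An OP alphabet is a pair $(\Sigma,M)$ where $\Sigma$ is a finite alphabet, $\#\notin\Sigma$, and $M$ (the operator precedence matrix, OPM) assigns to each ordered pair of symbols of $\Sigma\cup\{\#\}$ at most one of the relations $\lessdot,\doteq,\gtrdot$ (an entry may be empty); we write $a\lessdot b$, $a\doteq b$, $a\gtrdot b$. Always $\#\lessdot a$ and $a\gtrdot\#$ for all $a\in\Sigma$. For $w=a_1\cdots a_n\in\Sigma^+$ put $a_0=a_{n+1}=\#$. The chain relation $\curvearrowright$ on $\{0,\dots,n+1\}$ is defined inductively: for $i<j$, $i\curvearrowright j$ if there are positions $i=k_1<\dots<k_m=j$ with $a_{k_1}\lessdot a_{k_2}\doteq\dots\doteq a_{k_{m-1}}\gtrdot a_{k_m}$ and, for each $s\in\{1,\dots,m-1\}$, either $k_s+1=k_{s+1}$ or $k_s\curvearrowright k_{s+1}$. The word $w$ is compatible with $M$ if $0\curvearrowright n+1$; $(\Sigma,M)^+$ is the set of all non-empty words over $\Sigma$ compatible with $M$ (for the complete OPM of this statement it is $\Sigma^+$). Automata. An OPA over $(\Sigma,M)$ is $(Q,I,F,\delta)$ with $Q$ a finite set of states, $I,F\subseteq Q$ (initial, final), and $\delta=(\delta_{\mathrm{shift}},\delta_{\mathrm{push}},\delta_{\mathrm{pop}})$, $\delta_{\mathrm{shift}},\delta_{\mathrm{push}}\subseteq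 Q\times\Sigma\times Q$, $\delta_{\mathrm{pop}}\subseteq Q\times Q\times Q$. A weighted OPA (wOPA) over $(\Sigma,M)$ and $\mathbb{K}$ is $(Q,I,F,\delta,\mathrm{wt})$ with $(Q,I,F,\delta)$ an OPA and $\mathrm{wt}=(\mathrm{wt}_{\mathrm{shift}},\mathrm{wt}_{\mathrm{push}},\mathrm{wt}_{\mathrm{pop}})$, $\mathrm{wt}_{op}:\delta_{op}\to K$. It is restricted (an rwOPA) if $\mathrm{wt}_{\mathrm{pop}}\equiv 1$. A configuration is $\langle\Pi,q,u\#,k\rangle$ with stack $\Pi\in\bot(\Sigma\times Q)^*$, state $q$, remaining input $u\#$, and $k\in K$. With $a$ the topmost alphabet symbol of the stack ($a=\#$ if the stack is $\bot$) and $b$ the next input symbol, moves are: push: $\langle\Pi,q,bx,k\rangle\vdash\langle\Pi[b,q],r,x,k\cdot\mathrm{wt}_{\mathrm{push}}(q,b,r)\rangle$ if $a\lessdot b$, $(q,b,r)\in\delta_{\mathrm{push}}$; shift: $\langle\Pi[a,p],q,bx,k\rangle\vdash\langle\Pi[b,p],r,x,k\cdot\mathrm{wt}_{\mathrm{shift}}(q,b,r)\rangle$ if $a\doteq b$, $(q,b,r)\in\delta_{\mathrm{shift}}$; pop: $\langle\Pi[a,p],q,bx,k\rangle\vdash\langle\Pi,r,bx,k\cdot\mathrm{wt}_{\mathrm{pop}}(q,p,r)\rangle$ if $a\gtrdot b$, $(q,p,r)\in\delta_{\mathrm{pop}}$. An accepting run on $w$ is a finite sequence of moves from $\langle\bot,q_I,w\#,1\rangle$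 to $\langle\bot,q_F,\#,k\rangle$ with $q_I\in I$, $q_F\in F$; its weight is $k$. The behavior $[\![\mathcal{B}]\!]:(\Sigma,M)^+\to K$ maps $w$ to the sum of the weights of all accepting runs of $\mathcal{B}$ on $w$. Weighted nested word automata. A wNWA over $\Sigma$ and $\mathbb{K}$ is $\mathcal{A}=(Q,I,F,(\delta_{\mathrm{call}},\delta_{\mathrm{int}},\delta_{\mathrm{ret}}),(\mathrm{wt}_{\mathrm{call}},\mathrm{wt}_{\mathrm{int}},\mathrm{wt}_{\mathrm{ret}}))$ with $Q$ finite, $I,F\subseteq Q$, $\delta_{\mathrm{call}}\subseteq Q\times\Sigma_{\mathrm{call}}\times Q$, $\delta_{\mathrm{int}}\subseteq Q\times\Sigma_{\mathrm{int}}\times Q$, $\delta_{\mathrm{ret}}\subseteq Q\times Q\times\Sigma_{\mathrm{ret}}\times Q$, and weight functions $\mathrm{wt}_{op}:\delta_{op}\to K$. In a word $w=a_1\cdots a_n\in\Sigma^+$ (viewed as a nested word) calls and returns are matched in the usual well-nested (LIFO) way; unmatched ones are pending. An accepting run on $w$ is a sequence $q_0,\dots,q_n$ of states with $q_0\in I$, $q_n\in F$ such that for each $i$: $(q_{i-1},a_i,q_i)\in\delta_{\mathrm{call}}$ if $a_i$ is a call; $(q_{i-1},a_i,q_i)\in\delta_{\mathrm{int}}$ if $a_i$ is an internal; $(q_{i-1},q_{j-1},a_i,q_i)\in\delta_{\mathrm{ret}}$ if $a_i$ is a return matched with the call at position $j$; $(q_{i-1},q_0,a_i,q_i)\in\delta_{\mathrm{ret}}$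 if $a_i$ is a pending return. The weight of the run is the product, in the order $i=1,\dots,n$, of the weights of these transitions, and $[\![\mathcal{A}]\!](w)$ is the sum of the weights of all accepting runs on $w$. *)

(* Defs.v *)
From HB Require Import structures.
From mathcomp Require Import all_boot all_order all_algebra.
From mathcomp Require Import all_classical.

Set Implicit Arguments.
Unset Strict Implicit.
Unset Printing Implicit Defensive.

Import GRing.Theory.

Local Open Scope classical_set_scope.
Local Open Scope ring_scope.

Variant precedence := Yields | Equal | Takes.

(* The delimiter # is [None]; [opm_rel x y = None] is an empty matrix entry. *)
Record opm (S : finType) := OPM {
  opm_rel :> option S -> option S -> option precedence;
  opm_hashl : forall a : S, opm_rel None (Some a) = Some Yields;
  opm_hashr : forall a : S, opm_rel (Some a) None = Some Takes
}.

Notation "a ⋖[ M ] b" := (opm_rel M a b = Some Yields)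
  (at level 70, format "a  ⋖[ M ]  b").
Notation "a ≐[ M ] b" := (opm_rel M a b = Some Equal)
  (at level 70, format "a  ≐[ M ]  b").
Notation "a ⋗[ M ] b" := (opm_rel M a b = Some Takes)
  (at level 70, format "a  ⋗[ M ]  b").

Section Chains.
Variables (S : finType) (M : opm S) (w : seq S).

(* The letters of [w] occupy the positions 1, ..., [size w]; the positions 0
   and [(size w).+1] carry #. *)
Definition letter (i : nat) : option S :=
  if i is i'.+1 then onth w i' else None.

(* The positions of a chain are k 1 < ... < k m; the other values of [k] are
   irrelevant. The pattern "first ⋖, last ⋗" forces m >= 3. *)
Inductive chain : nat -> nat -> Prop :=
| Chain (m : nat) (k : nat -> nat) :
    (2 < m)%N ->
    (forall s, (0 < s < m)%N -> (k s < k s.+1)%N) ->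
    (k m <= (size w).+1)%N ->
    letter (k 1%N) ⋖[M] letter (k 2%N) ->
    (forall s, (1 < s < m.-1)%N -> letter (k s) ≐[M] letter (k s.+1)) ->
    letter (k m.-1) ⋗[M] letter (k m) ->
    (forall s, (0 < s < m)%N ->
       (k s).+1 = k s.+1 \/ chain (k s) (k s.+1)) ->
    chain (k 1%N) (k m).

Definition compatible : Prop := chain 0 (size w).+1.

End Chains.

Definition op_words (S : finType) (M : opm S) : set (seq S) :=
  [set w | w != [::] /\ compatible M w].

Record opa (S : finType) (M : opm S) := OPA {
  op_state : finType;
  op_init : {set op_state};
  op_final : {set op_state};
  op_shift : {set op_state * S * op_state};
  op_push : {set op_state * S * op_state};
  op_pop : {set op_state * op_state * op_state}
}.

(* The weight functions are total; only their values on the corresponding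
   transition relations are ever used. *)
Record wopa (S : finType) (M : opm S) (K : pzSemiRingType) := WOPA {
  wopa_opa :> opa M;
  wt_shift : op_state wopa_opa -> S -> op_state wopa_opa -> K;
  wt_push : op_state wopa_opa -> S -> op_state wopa_opa -> K;
  wt_pop : op_state wopa_opa -> op_state wopa_opa -> op_state wopa_opa -> K
}.

Definition restricted (S : finType) (M : opm S) (K : pzSemiRingType)
    (B : wopa M K) : Prop :=
  forall q p r, (q, p, r) \in op_pop B -> wt_pop q p r = 1.

Section Behavior.
Variables (S : finType) (M : opm S) (K : pzSemiRingType) (B : wopa M K).
Local Notation Q := (op_state B).

(* The configuration <P, q, u#, k> is [(P, q, u, k)]: the top of the stack is
   the head of [P], the bottom symbol and the end marker # are left implicit. *)
Definition config : choiceType := (seq (S * Q) * Q * seq S * K)%type.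

Definition top_symbol (P : seq (S * Q)) : option S := ohead (unzip1 P).

Inductive move : config -> config -> Prop :=
| Push P q b x r k :
    top_symbol P ⋖[M] Some b -> (q, b, r) \in op_push B ->
    move (P, q, b :: x, k) ((b, q) :: P, r, x, k * wt_push q b r)
| Shift P a p q b x r k :
    Some a ≐[M] Some b -> (q, b, r) \in op_shift B ->
    move ((a, p) :: P, q, b :: x, k) ((b, p) :: P, r, x, k * wt_shift q b r)
| Pop P a p q u r k :
    Some a ⋗[M] ohead u -> (q, p, r) \in op_pop B ->
    move ((a, p) :: P, q, u, k) (P, r, u, k * wt_pop q p r).

(* A run is the sequence of all its configurations; consecutive configurations
   determine the transition used between them. *)
Definition accepting_runs (w : seq S) : set (seq config) :=
  [set c | exists qI qF k cs,
     [/\ c = ([::], qI, w, 1) :: cs,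
         qI \in op_init B,
         qF \in op_final B,
         path (fun c1 c2 => `[< move c1 c2 >]) ([::], qI, w, 1) cs &
         last ([::], qI, w, 1) cs = ([::], qF, [::], k) ] ].

Definition run_weight (c : seq config) : K := last 0 [seq x.2 | x <- c].

(* The index set of this finitely supported sum is finite, by
   [accepting_runs_finite] below. *)
Definition wopa_behavior (w : seq S) : K :=
  \sum_(c \in accepting_runs w) run_weight c.

Let measure (c : config) : nat := (size c.1.1.1 + (size c.1.2).*2)%N.

Let move_measure c1 c2 : move c1 c2 -> (measure c2 < measure c1)%N.
Proof.
case=> [P q b x r k _ _|P a p q b x r k _ _|P a p q u r k _ _] /=;
  by rewrite /measure /= ?doubleS ?addSn ?addnS ltnS // leqW.
Qed.

Let move_finite c1 : finite_set [set c2 | move c1 c2].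
Proof.
case: c1 => [[[P q] u] k].
pose f (r : Q) : config := if u is b :: x
  then ((b, q) :: P, r, x, k * wt_push q b r) else (P, r, u, k).
pose g (r : Q) : config := if (P, u) is ((_, p) :: P', b :: x)
  then ((b, p) :: P', r, x, k * wt_shift q b r) else (P, r, u, k).
pose h (r : Q) : config := if P is (_, p) :: P'
  then (P', r, u, k * wt_pop q p r) else (P, r, u, k).
apply: (@sub_finite_set _ _ (range f `|` range g `|` range h)); last first.
  by rewrite !finite_setU; do ![split]; apply: finite_image; exact: finite_finset.
move=> c2 /= H; inversion H; subst.
- by left; left; exists r.
- by left; right; exists r.
- by right; exists r.
Qed.

Let paths_finite (n : nat) (c : config) : (measure c < n)%N ->
  finite_set [set cs | path (fun c1 c2 => `[< move c1 c2 >]) c cs].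
Proof.
elim: n c => // n IHn c; rewrite ltnS => cn.
apply: (@sub_finite_set _ _ ([set [::]] `|`
  \bigcup_(c' in [set c' | move c c']) [set c' :: cs | cs in
    [set cs | path (fun c1 c2 => `[< move c1 c2 >]) c' cs]])).
  move=> [|c' cs] /=; first by left.
  by case/andP => /asboolP cc' cs_path; right; exists c' => //=; exists cs.
rewrite finite_setU; split; first exact: finite_set1.
apply: bigcup_finite => [|c' /= cc']; first exact: move_finite.
by apply/finite_image/IHn/(leq_trans (move_measure cc') cn).
Qed.

Lemma accepting_runs_finite (w : seq S) : finite_set (accepting_runs w).
Proof.
apply: (@sub_finite_set _ _ (\bigcup_(q in [set: Q])
  [set (([::], q, w, 1) : config) :: cs | cs in
    [set cs | path (fun c1 c2 => `[< move c1 c2 >]) ([::], q, w, 1) cs]])).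
  by move=> c [qI [qF [k [cs [-> _ _ cs_path _]]]]]; exists qI => //; exists cs.
apply: bigcup_finite => [|q _]; first exact: finite_finset.
exact/finite_image/(paths_finite (ltnSn _)).
Qed.

End Behavior.

(* A visibly pushdown alphabet is a finite type [S] with a map
   [kind : S -> letter_kind], whose fibres are the three parts of [S]. *)
Variant letter_kind := Call | Int | Ret.

Definition vp_rel (S : finType) (kind : S -> letter_kind)
    (x y : option S) : option precedence :=
  match x, y with
  | None, None => None
  | None, Some _ => Some Yields
  | Some _, None => Some Takes
  | Some a, Some b =>
      match kind a, kind b with
      | Call, (Call | Int) => Some Yields
      | Call, Ret => Some Equal
      | (Int | Ret), _ => Some Takes
      end
  end.

Definition vp_opm (S : finType) (kind : S -> letter_kind) : opm S :=
  @OPM S (vp_rel kind) (fun=> erefl) (fun=> erefl).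

(* In a return transition [(q, h, a, r)], [h] is the hierarchical state. As for
   [wopa], only the values of the weight functions on transitions matter. *)
Record wnwa (S : finType) (kind : S -> letter_kind) (K : pzSemiRingType) :=
  WNWA {
    nw_state : finType;
    nw_init : {set nw_state};
    nw_final : {set nw_state};
    nw_call : {set nw_state * S * nw_state};
    nw_int : {set nw_state * S * nw_state};
    nw_ret : {set nw_state * nw_state * S * nw_state};
    nw_callP : forall q a r, (q, a, r) \in nw_call -> kind a = Call;
    nw_intP : forall q a r, (q, a, r) \in nw_int -> kind a = Int;
    nw_retP : forall q h a r, (q, h, a, r) \in nw_ret -> kind a = Ret;
    wt_call : nw_state -> S -> nw_state -> K;
    wt_int : nw_state -> S -> nw_state -> K;
    wt_ret : nw_state -> nw_state -> S -> nw_state -> K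
  }.

Section NestedWords.
Variables (S : finType) (kind : S -> letter_kind) (K : pzSemiRingType).

(* Stack of the indices of the calls still open after the first [i] letters of
   [w], innermost first. Letters are indexed from 0 here, so that the letter of
   index [i] is read between the states number [i] and [i.+1] of a run. *)
Fixpoint open_calls (w : seq S) (i : nat) : seq nat :=
  if i is i'.+1 then
    if onth w i' is Some a then
      match kind a with
      | Call => i' :: open_calls w i'
      | Int => open_calls w i'
      | Ret => behead (open_calls w i')
      end
    else open_calls w i'
  else [::].

(* Index of the call matched by a return of index [i]; [None] if that return is
   pending. *)
Definition matching_call (w : seq S) (i : nat) : option nat :=
  ohead (open_calls w i).

Variables (A : wnwa kind K) (w : seq S).
Local Notation Q := (nw_state A).
Local Notation n := (size w).

Implicit Types (q : {ffun 'I_n.+1 -> Q}) (i : 'I_n).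

Definition source q i : Q := q (widen_ord (leqnSn n) i).
Definition target q i : Q := q (lift ord0 i).
Definition hier q i : Q :=
  if matching_call w i is Some j then q (inord j) else q ord0.

Definition nw_transition q i : bool :=
  let a := tnth (in_tuple w) i in
  match kind a with
  | Call => (source q i, a, target q i) \in nw_call A
  | Int => (source q i, a, target q i) \in nw_int A
  | Ret => (source q i, hier q i, a, target q i) \in nw_ret A
  end.

Definition nw_transition_weight q i : K :=
  let a := tnth (in_tuple w) i in
  match kind a with
  | Call => wt_call (source q i) a (target q i)
  | Int => wt_int (source q i) a (target q i)
  | Ret => wt_ret (source q i) (hier q i) a (target q i)
  end.

Definition nw_accepting q : bool :=
  [&& q ord0 \in nw_init A, q ord_max \in nw_final A &
      [forall i, nw_transition q i]].

Definition wnwa_behavior : K :=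
  \sum_(q : {ffun 'I_n.+1 -> Q} | nw_accepting q)
    \prod_(i < n) nw_transition_weight q i.

End NestedWords.

(* Main.v *)
(** The simulating automaton keeps in its state, next to the state [q] of the
    nested word automaton, the hierarchical state [h] that a return read next
    would use: the state before the innermost open call, or the initial state
    if there is none. The weight of a return is then known when the return is
    read, by a shift if it is matched and by a push if it is pending, so that
    pops need no weight. Reading a call pushes [(q, h)] and makes [q] the new
    hierarchical state; internals and returns are popped immediately after
    being read, and a pop restores the hierarchical state saved on the stack.
    Pops are deterministic, hence the accepting runs of the two automata
    correspond bijectively. *)
Require Import Defs.
From mathcomp Require Import all_boot all_order all_algebra.
From mathcomp Require Import all_classical.

Section Simulation.
Set Implicit Arguments.
Unset Strict Implicit.
Unset Printing Implicit Defensive.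
Import GRing.Theory.
Local Open Scope ring_scope.
Variables (K : pzSemiRingType) (S : finType) (kind : S -> letter_kind).
Variable A : wnwa kind K.
Local Notation Q := (nw_state A).

(** * Construction of the simulating automaton *)

Definition nw_step (q h : Q) (a : S) (r : Q) : bool :=
  match kind a with
  | Call => (q, a, r) \in nw_call A
  | Int => (q, a, r) \in nw_int A
  | Ret => (q, h, a, r) \in nw_ret A
  end.

Definition nw_step_weight (q h : Q) (a : S) (r : Q) : K :=
  match kind a with
  | Call => wt_call q a r
  | Int => wt_int q a r
  | Ret => wt_ret q h a r
  end.

(** After an internal or a return the value [x.2] is only a placeholder: the pop that follows at
    once overwrites it with the one saved on the stack. *)
Definition next_hier (a : S) (x : Q * Q) : Q :=
  if kind a is Call then x.1 else x.2.

(* Serves both as push and as shift relation: the precedence relation alone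
   selects the kind of move. *)
Definition read_transitions : {set (Q * Q) * S * (Q * Q)} :=
  finset (fun t : (Q * Q) * S * (Q * Q) =>
    nw_step t.1.1.1 t.1.1.2 t.1.2 t.2.1 && (t.2.2 == next_hier t.1.2 t.1.1)).

(** Initial states have the form [(q, q)] because a pending return takes the initial state as its
    hierarchical state. *)
Definition sim_opa : opa (vp_opm kind) :=
  @OPA S (vp_opm kind) (Q * Q)%type
    (finset (fun x : Q * Q => (x.1 \in nw_init A) && (x.2 == x.1)))
    (finset (fun x : Q * Q => x.1 \in nw_final A))
    read_transitions read_transitions
    (finset (fun t : (Q * Q) * (Q * Q) * (Q * Q) =>
       t.2 == (t.1.1.1, t.1.2.2))).

Definition read_weight (x : Q * Q) (a : S) (y : Q * Q) : K :=
  nw_step_weight x.1 x.2 a y.1.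

Definition sim : wopa (vp_opm kind) K :=
  @WOPA S (vp_opm kind) K sim_opa read_weight read_weight (fun _ _ _ => 1).

(** * Moves of the simulating automaton *)

Local Notation stack := (seq (S * (Q * Q))).
Local Notation top := (@top_symbol S _ K sim).
Local Notation move := (@move S _ K sim).
Implicit Types (P : stack) (x p : Q * Q) (u w : seq S) (k : K) (c : config sim).

(** The precedence excludes the other two kinds of move, and the new hierarchical component is a
    function of the source and the letter, so only [r] is free. *)
Lemma move_push P x b u k c :
    vp_rel kind (top P) (Some b) = Some Yields ->
  move (P, x, b :: u, k) c <->
  exists2 r, nw_step x.1 x.2 b r &
    c = ((b, x) :: P, (r, next_hier b x), u, k * nw_step_weight x.1 x.2 b r).
Proof.
move=> Pb; split=> [cP|[r xr ->]].
  inversion cP as [? ? ? ? [r h] ? _ xr|? ? ? ? ? ? ? ? Pb'|? ? ? ? ? ? ? Pb'];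
    subst; try by move: Pb; rewrite [LHS]Pb'.
  by move: xr; rewrite inE /= => /andP[xr /eqP ->]; exists r.
have xb : (x, b, (r, next_hier b x)) \in op_push sim by rewrite inE /= xr eqxx.
exact: (@Push S _ K sim P x b u _ k Pb xb).
Qed.

Lemma move_shift P a p x b u k c :
    vp_rel kind (Some a) (Some b) = Some Equal ->
  move ((a, p) :: P, x, b :: u, k) c <->
  exists2 r, nw_step x.1 x.2 b r &
    c = ((b, p) :: P, (r, next_hier b x), u, k * nw_step_weight x.1 x.2 b r).
Proof.
move=> Pb; split=> [cP|[r xr ->]].
  inversion cP as [? ? ? ? ? ? Pb'|? ? ? ? ? ? [r h] ? _ xr|? ? ? ? ? ? ? Pb'];
    subst; try by move: Pb; rewrite [LHS]Pb'.
  by move: xr; rewrite inE /= => /andP[xr /eqP ->]; exists r.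
have xb : (x, b, (r, next_hier b x)) \in op_shift sim by rewrite inE /= xr eqxx.
exact: (@Shift S _ K sim P a p x b u _ k Pb xb).
Qed.

Lemma move_pop P a p x u k c : vp_rel kind (Some a) (ohead u) = Some Takes ->
  move ((a, p) :: P, x, u, k) c <-> c = (P, (x.1, p.2), u, k).
Proof.
move=> Pb; split=> [cP|->].
  inversion cP as [? ? ? ? ? ? Pb'|? ? ? ? ? ? ? ? Pb'|? ? ? ? ? ? ? _ xr];
    subst; try by move: Pb; rewrite [LHS]Pb'.
  by move: xr; rewrite inE /= mulr1 => /eqP ->.
have xp : (x, p, (x.1, p.2)) \in op_pop sim by rewrite inE.
by have := @Pop S _ K sim P a p x u _ k Pb xp; rewrite /= mulr1.
Qed.

Lemma move_push_step P x b u k r :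
    vp_rel kind (top P) (Some b) = Some Yields ->
  `[< move (P, x, b :: u, k)
       ((b, x) :: P, (r, next_hier b x), u, k * nw_step_weight x.1 x.2 b r) >]
  = nw_step x.1 x.2 b r.
Proof.
move=> Pb; apply/asboolP/idP => [/(move_push _ _ _ _ Pb)[r' ? [->]] //|xr].
by apply/(move_push _ _ _ _ Pb); exists r.
Qed.

Lemma move_shift_step P a p x b u k r :
    vp_rel kind (Some a) (Some b) = Some Equal ->
  `[< move ((a, p) :: P, x, b :: u, k)
       ((b, p) :: P, (r, next_hier b x), u, k * nw_step_weight x.1 x.2 b r) >]
  = nw_step x.1 x.2 b r.
Proof.
move=> ab; apply/asboolP/idP => [/(move_shift _ _ _ _ _ _ ab)[r' ? [->]] //|xr].
by apply/(move_shift _ _ _ _ _ _ ab); exists r.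
Qed.

Lemma move_pop_step P a p q h u k :
    vp_rel kind (Some a) (ohead u) = Some Takes ->
  `[< move ((a, p) :: P, (q, h), u, k) (P, (q, p.2), u, k) >].
Proof. by move=> au; apply/asboolP/(move_pop _ _ _ _ _ au). Qed.

(** * Runs determined by the states after each letter *)

Local Notation is_move := (fun c1 c2 : config sim => `[< move c1 c2 >]).

Fixpoint unwind P x k : seq (config sim) :=
  if P is (_, p) :: P' then (P', (x.1, p.2), [::], k) :: unwind P' (x.1, p.2) k
  else [::].

(* The run from stack [P] and state [x] on [u] in which [s] lists the states of
   the nested word automaton after each letter; junk if the sizes of [u] and
   [s] differ. *)
Fixpoint trace u P x k (s : seq Q) : seq (config sim) :=
  match u, s with
  | a :: u', r :: s' =>
      let k' := k * nw_step_weight x.1 x.2 a r in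
      let y := (r, next_hier a x) in
      match kind a, P with
      | Call, _ =>
          ((a, x) :: P, y, u', k') :: trace u' ((a, x) :: P) y k' s'
      | Int, _ | Ret, [::] =>
          [:: ((a, x) :: P, y, u', k'), (P, (r, x.2), u', k')
            & trace u' P (r, x.2) k' s']
      | Ret, (_, p) :: P' =>
          [:: ((a, p) :: P', y, u', k'), (P', (r, p.2), u', k')
            & trace u' P' (r, p.2) k' s']
      end
  | _, _ => unwind P x k
  end.

(* The stacks between two letters: an internal or a return on top has been
   popped, so only open calls remain. *)
Definition open_stack P : bool :=
  all (fun y => if kind y.1 is Call then true else false) P.

Lemma vp_yields P a : open_stack P -> kind a <> Ret ->
  vp_rel kind (top P) (Some a) = Some Yields.
Proof.
by case: P => [|[b p] P] //= /andP[]; case: (kind b) => // _ _; case: (kind a).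
Qed.

Lemma vp_takes a b : kind a <> Call -> vp_rel kind (Some a) b = Some Takes.
Proof. by case: b => //= b; case: (kind a). Qed.

(** Each letter leaves its target state [r] in the configuration that follows, so the states can be
    read off the run. *)
Lemma trace_inj u P x k : {in [pred s | size s == size u] &,
  injective (trace u P x k)}.
Proof.
elim: u P x k => [|a u IHu] P x k [|r s] [|r' s'] //=.
rewrite !inE !eqSS => su s'u.
case: (kind a); [|case: P => [|[b p] P]..] => /=; case=> -> *.
all: by congr (_ :: _); apply: IHu; eassumption.
Qed.

Lemma unwind_complete P x k cs y k' : path is_move (P, x, [::], k) cs ->
  last (P, x, [::], k) cs = ([::], y, [::], k') -> cs = unwind P x k.
Proof.
elim: P x cs => [|[a p] P IHP] x [|c cs] //=.
  by case/andP=> /asboolP cP; inversion cP.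
case/andP=> /asboolP /move_pop cP.
by rewrite cP// => cs_path cs_last; congr (_ :: _); apply: IHP.
Qed.

(** The matrix fixes the kind of each move and pops are deterministic, so the only choices are the
    target states of the reading moves; these form [s]. *)
Lemma trace_complete u P x k cs y k' : open_stack P ->
  path is_move (P, x, u, k) cs ->
  last (P, x, u, k) cs = ([::], y, [::], k') ->
  exists2 s, size s = size u & cs = trace u P x k s.
Proof.
elim: u P x k cs => [|a u IHu] P x k cs Popen.
  move=> cs_path cs_last; exists [::] => //.
  exact: unwind_complete cs_path cs_last.
case: cs => [|c cs] //=.
case/andP=> /asboolP.
(* Common to internals and pending returns: the letter is pushed on [P], and the next move must pop
   it. *)
have pushpop : vp_rel kind (top P) (Some a) = Some Yields ->
    kind a <> Call ->
    move (P, x, a :: u, k) c -> path is_move c cs ->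
    last c cs = ([::], y, [::], k') ->
    exists r s, size s = size u /\
      c :: cs = [:: ((a, x) :: P, (r, next_hier a x), u,
                     k * nw_step_weight x.1 x.2 a r),
                    (P, (r, x.2), u, k * nw_step_weight x.1 x.2 a r)
            & trace u P (r, x.2) (k * nw_step_weight x.1 x.2 a r) s].
  move=> Pa aNC /(move_push _ _ _ _ Pa) [r xr ->].
  (* The run cannot stop here, since its last stack is empty. *)
  case: cs => [|c' cs] //= /andP[].
  move=> /asboolP /(move_pop _ _ _ _ _ (vp_takes _ aNC)) -> cs_path cs_last.
  by have [s us ->] := IHu _ _ _ _ Popen cs_path cs_last; exists r, s.
have [aC|aI|aR] : [\/ kind a = Call, kind a = Int | kind a = Ret].
  by case: (kind a); [constructor 1|constructor 2|constructor 3].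
- have Pa : vp_rel kind (top P) (Some a) = Some Yields.
    by apply: vp_yields => //; rewrite aC.
  move=> /(move_push _ _ _ _ Pa) [r xr ->] cs_path cs_last.
  have [|s us ->] := IHu _ _ _ _ _ cs_path cs_last; first by rewrite /= aC.
  by exists (r :: s); rewrite /= ?us ?aC.
- move=> cP cs_path cs_last; case: pushpop => // [||r [s [us ->]]].
  + by apply: vp_yields => //; rewrite aI.
  + by rewrite aI.
  by exists (r :: s); rewrite /= ?us ?aI.
- have aNC : kind a <> Call by rewrite aR.
  case: P Popen pushpop => [|[b p] P] Popen pushpop cP cs_path cs_last.
    case: pushpop => // [r [s [us ->]]].
    by exists (r :: s); rewrite /= ?us ?aR.
  have [bC PC] : kind b = Call /\ open_stack P.
    by move: Popen => /= /andP[]; case: (kind b).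
  have ba : vp_rel kind (Some b) (Some a) = Some Equal by rewrite /= bC aR.
  move: cP cs_path cs_last => /(move_shift _ _ _ _ _ _ ba) [r xr ->].
  case: cs {pushpop} => [|c' cs] //= /andP[].
  move=> /asboolP /(move_pop _ _ _ _ _ (vp_takes _ aNC)) -> cs_path cs_last.
  have [s us ->] := IHu _ _ _ _ PC cs_path cs_last.
  by exists (r :: s); rewrite /= ?us ?aR.
Qed.

(** * Traces follow the nesting structure of the word *)

Lemma onth_ohead_drop (T : Type) (t : seq T) i : onth t i = ohead (drop i t).
Proof. by elim: t i => [|b t IHt] [|i] /=; rewrite ?onth0n. Qed.

(** State sequences are functions on [nat] here, which keeps ordinals out of the induction on the
    remaining input. *)
Definition hier_at w (f : nat -> Q) i : Q :=
  if matching_call kind w i is Some j then f j else f 0%N.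

Definition step_at w f i : bool :=
  if onth w i is Some a then nw_step (f i) (hier_at w f i) a (f i.+1)
  else false.

Definition weight_at w f i : K :=
  if onth w i is Some a then nw_step_weight (f i) (hier_at w f i) a (f i.+1)
  else 1.

Lemma unwind_correct P x k :
  path is_move (P, x, [::], k) (unwind P x k) /\
  exists h, last (P, x, [::], k) (unwind P x k) = ([::], (x.1, h), [::], k).
Proof.
elim: P x => [|[a p] P IHP] [q h] /=; first by split=> //; exists h.
have [E [h' Eh]] := IHP (q, p.2); split; last by exists h'.
by rewrite E andbT; apply/asboolP/move_pop.
Qed.

(** The invariant: [x.2] and the hierarchical states saved on the stack, from the top down, are the
    states before the open calls, innermost first, followed by the initial state. A call adds the
    current state in front, a matched return removes the head, and other letters change nothing. *)
Lemma trace_correct w f u i P x k :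
  drop i w = u -> open_stack P -> x.1 = f i ->
  x.2 :: [seq y.2.2 | y <- P] =
    rcons [seq f j | j <- open_calls kind w i] (f 0%N) ->
  let s := [seq f j | j <- iota i.+1 (size u)] in
  path is_move (P, x, u, k) (trace u P x k s) =
    all (step_at w f) (iota i (size u)) /\
  exists h, last (P, x, u, k) (trace u P x k s) =
    ([::], (f (i + size u)%N, h), [::],
     k * \prod_(j <- iota i (size u)) weight_at w f j).
Proof.
elim: u i P x k => [|a u IHu] i P x k wu Popen xi xP /=.
  have [-> [h ->]] := unwind_correct P x k; split=> //.
  by exists h; rewrite big_nil mulr1 addn0 xi.
have wi : onth w i = Some a by rewrite onth_ohead_drop wu.
have wu' : drop i.+1 w = u by rewrite -add1n -drop_drop wu /= drop0.
(* The heads of both sides of the invariant agree. *)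
have xh : x.2 = hier_at w f i.
  rewrite /hier_at /matching_call.
  by case: (open_calls kind w i) xP => [|j js] [].
rewrite big_cons addnS -addSn mulrA /step_at /weight_at wi -xi -xh.
set k' := k * _.
have IH P' h' : open_stack P' ->
  h' :: [seq y.2.2 | y <- P'] =
    rcons [seq f j | j <- open_calls kind w i.+1] (f 0%N) -> _ :=
  fun oP => IHu i.+1 P' (f i.+1, h') k' wu' oP erefl.
have [aC|aI|aR] : [\/ kind a = Call, kind a = Int | kind a = Ret].
  by case: (kind a); [constructor 1|constructor 2|constructor 3].
- rewrite aC /=; have [] := IH ((a, x) :: P) (next_hier a x).
  - by rewrite /= aC.
  - by rewrite /= /next_hier wi aC /= xP xi.
  move=> -> [h ->]; split; last by exists h.
  by congr andb; apply/move_push_step/vp_yields; rewrite ?aC.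
- have aNC : kind a <> Call by rewrite aI.
  rewrite aI /=; have [|-> [h ->]] := IH P x.2 Popen; first by rewrite /= wi aI.
  split; last by exists h.
  rewrite move_push_step; last by apply: vp_yields; rewrite ?aI.
  by rewrite (move_pop_step _ _ _ _ _ (vp_takes _ aNC)).
- have aNC : kind a <> Call by rewrite aR.
  rewrite aR; case: P Popen xP => [|[b p] P] Popen xP /=.
    have [||-> [h ->]] := IH [::] x.2 => //.
      (* With an empty stack both sides of the invariant have one element, so no call is open and
         the return is pending. *)
      by rewrite /= wi aR; case: (open_calls kind w i) xP => [|? []].
    split; last by exists h.
    rewrite move_push_step //.
    by rewrite (move_pop_step _ _ _ _ _ (vp_takes _ aNC)).
  have [bC PC] : kind b = Call /\ open_stack P.
    by move: Popen => /= /andP[]; case: (kind b).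
  have ba : vp_rel kind (Some b) (Some a) = Some Equal by rewrite /= bC aR.
  have [|-> [h ->]] := IH P p.2 PC.
    by rewrite /= wi aR; case: (open_calls kind w i) xP => [|? js] [].
  split; last by exists h.
  rewrite (move_shift_step _ _ _ _ _ _ ba).
  by rewrite (move_pop_step _ _ _ _ _ (vp_takes _ aNC)).
Qed.

(** * Bijection between the accepting runs of the two automata *)

Section Runs.
Variable w : seq S.
Implicit Type f : {ffun 'I_(size w).+1 -> Q}.

Definition run_of f : seq (config sim) :=
  ([::], (f ord0, f ord0), w, 1) ::
  trace w [::] (f ord0, f ord0) 1 [seq f (inord j) | j <- iota 1 (size w)].

Lemma onth_tnth (i : 'I_(size w)) : onth w i = Some (tnth (in_tuple w) i).
Proof.
pose a := tnth (in_tuple w) i.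
by rewrite (tnth_nth a) onthE (nth_map a).
Qed.

Lemma inord0 n : inord 0 = ord0 :> 'I_n.+1.
Proof. by apply: val_inj; rewrite /= inordK. Qed.

Lemma source_inord f (i : 'I_(size w)) : source f i = f (inord i).
Proof.
by congr (f _); apply: val_inj; rewrite /= inordK // ltnS ltnW.
Qed.

Lemma target_inord f (i : 'I_(size w)) : target f i = f (inord i.+1).
Proof. by congr (f _); apply: val_inj; rewrite /= inordK // ltnS. Qed.

Lemma hier_inord f (i : 'I_(size w)) :
  hier f i = hier_at w (fun j => f (inord j)) i.
Proof. by rewrite /hier /hier_at inord0. Qed.

Lemma step_at_transition f (i : 'I_(size w)) :
  step_at w (fun j => f (inord j)) i = nw_transition f i.
Proof.
by rewrite /step_at onth_tnth -source_inord -hier_inord -target_inord.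
Qed.

Lemma weight_at_transition f (i : 'I_(size w)) :
  weight_at w (fun j => f (inord j)) i = nw_transition_weight f i.
Proof.
by rewrite /weight_at onth_tnth -source_inord -hier_inord -target_inord.
Qed.

(** This is [trace_correct] from the empty stack. The equality of booleans serves both directions:
    [run_of_accepting] and [run_of_surj]. *)
Lemma run_of_spec f :
  path is_move ([::], (f ord0, f ord0), w, 1) (behead (run_of f))
    = [forall i, nw_transition f i] /\
  exists h, last ([::], (f ord0, f ord0), w, 1) (run_of f) =
    ([::], (f ord_max, h), [::], \prod_(i < size w) nw_transition_weight f i).
Proof.
have i0 : f ord0 = f (inord 0) by rewrite inord0.
have [|E [h Eh]] := @trace_correct w (fun j => f (inord j)) w 0 [::]
  (f ord0, f ord0) 1 (drop0 _) isT i0; first by rewrite /= i0.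
split; last first.
  exists h; rewrite /= Eh mul1r add0n.
  congr (_, (f _, _), _, _); first by apply: val_inj; rewrite /= inordK.
  rewrite -{1}[size w]subn0 big_mkord; apply: eq_bigr => i _.
  exact: weight_at_transition.
rewrite /= E; apply/allP/forallP => [H i|H j].
  by rewrite -step_at_transition; apply: H; rewrite mem_iota ltn_ord.
rewrite mem_iota add0n => /= jw.
by rewrite -[j]/(nat_of_ord (Ordinal jw)) step_at_transition.
Qed.

Lemma run_weight_run_of f :
  run_weight (run_of f) = \prod_(i < size w) nw_transition_weight f i.
Proof.
have [_ [h /(congr1 (fun c : config sim => c.2))]] := run_of_spec f.
by rewrite -(last_map (fun c : config sim => c.2)).
Qed.

Lemma run_of_accepting f :
  nw_accepting f -> @accepting_runs _ _ _ sim w (run_of f).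
Proof.
case/and3P=> f0 fn ft; have [E [h Eh]] := run_of_spec f.
exists (f ord0, f ord0), (f ord_max, h),
  (\prod_(i < size w) nw_transition_weight f i), (behead (run_of f)).
split=> //; first by rewrite inE /= f0 eqxx.
- by rewrite inE.
- by rewrite E.
Qed.

Lemma run_of_surj (c : seq (config sim)) : @accepting_runs _ _ _ sim w c ->
  exists2 f, nw_accepting f & c = run_of f.
Proof.
case=> [[q h] [qF [k [cs [-> q0 qn cs_path cs_last]]]]].
move: q0 qn; rewrite !inE /= => /andP[q0 /eqP hq] qn; subst h.
have [s sw def_cs] := trace_complete (isT : open_stack [::]) cs_path cs_last.
(* The list [s] starts with the state after the first letter, so [q] goes in front; as a default
   value it is never reached. *)
pose f := [ffun i : 'I_(size w).+1 => nth q (q :: s) i].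
have f0 : f ord0 = q by rewrite ffunE.
have fs : [seq f (inord j) | j <- iota 1 (size w)] = s.
  apply: (@eq_from_nth _ q) => [|i]; rewrite size_map size_iota ?sw // => iw.
  by rewrite (nth_map 0%N) ?size_iota // nth_iota // ffunE inordK //= ltnS.
have def_run : ([::], (q, q), w, 1) :: cs = run_of f.
  by rewrite /run_of fs f0 def_cs.
exists f => //; have [E [h]] := run_of_spec f.
move: E; rewrite -def_run f0 /= cs_path cs_last => E [fn _].
by apply/and3P; split; rewrite ?f0 -?E //; move: qn; rewrite fn.
Qed.

(** The first configuration determines [f ord0], and [trace_inj] gives the later values. *)
Lemma run_of_inj : injective run_of.
Proof.
move=> f g [fg0 _]; rewrite fg0 => /trace_inj E.
apply/ffunP=> i; rewrite -[i]inord_val.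
case: i => [[|i] iw] /=; first by rewrite inord0.
have {E} : nth (g ord0) [seq f (inord j) | j <- iota 1 (size w)] i =
    nth (g ord0) [seq g (inord j) | j <- iota 1 (size w)] i.
  by rewrite E // inE size_map size_iota.
by rewrite !(nth_map 0%N) ?size_iota // nth_iota.
Qed.

End Runs.

(** Reindexing along the weight-preserving bijection [run_of], whose values on accepting state
    sequences list the index set without repetition. *)
Lemma sim_behavior w : wnwa_behavior A w = @wopa_behavior _ _ _ sim w.
Proof.
rewrite /wopa_behavior (@fsbigE _ _ _ _ _
  [seq run_of f | f <- enum (@nw_accepting _ kind K A w)]).
- rewrite big_map big_enum_cond; apply: eq_big => f; last first.
    by rewrite run_weight_run_of.
  rewrite unfold_in -/(nw_accepting f); case: (boolP (nw_accepting f)) => fA.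
    by rewrite (mem_set (run_of_accepting fA)).
  by rewrite andFb.
- by rewrite map_inj_uniq ?enum_uniq //; exact: run_of_inj.
- by move=> c /= /mapP[f]; rewrite mem_enum => fA ->; exact: run_of_accepting.
(* No accepting run is missing from the list, so the vanishing condition outside it holds
   vacuously. *)
- move=> c /run_of_surj[f fA ->] /mapP[]; exists f => //.
  by rewrite mem_enum.
Qed.

End Simulation.

Theorem theorem9 (K : pzSemiRingType) (S : finType) (kind : S -> letter_kind)
    (A : wnwa kind K) :
  exists B : wopa (vp_opm kind) K,
    restricted B /\
    (forall w : seq S, op_words (vp_opm kind) w ->
       wnwa_behavior A w = wopa_behavior B w).
Proof. by exists (sim A); split=> // w _; exact: sim_behavior. Qed.
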